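(* (Cauchy's integral theorem for the Schrödinger equation) Let $\Omega\subset\mathbb{C}$ be a domain, $u:\Omega\to\mathbb{R}$, and let $f_0,f_1:\Omega\to\mathbb{R}$ be two arbitrary nonvanishing solutions of $$(-\partial_z\partial_{\overline z}+u)f=0$$ in $\Omega$. Then for every closed rectifiable curve $\Gamma$ situated in a simply connected subdomain of $\Omega$, $$\operatorname{Re}\int_{\Gamma}\partial_z\!\left(\frac{f_1}{f_0}\right)dz+i\operatorname{Im}\int_{\Gamma}f_0^2\,\partial_z\!\left(\frac{f_1}{f_0}\right)dz=0.$$
   Context: $z=x+iy$, $dz=dx+i\,dy$. The operators are defined without the factor $1/2$: $\partial_{\overline z}=\frac{\partial}{\partial x}+i\frac{\partial}{\partial y}$, $\partial_z=\frac{\partial}{\partial x}-i\frac{\partial}{\partial y}$, so $\partial_z\partial_{\overline z}=\Delta$. In the two-dimensional setting $u$ and the solutions $f$ of the Schrödinger equation are real valued and twice continuously differentiable. *)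

(* Defs.v *)
(* Stdlib reals with Coquelicot. *)
From Stdlib Require Import Reals.
From Coquelicot Require Import Coquelicot.
Open Scope R_scope.

(** Coquelicot's [is_connected] is for subsets of [R] only. *)
Definition connected_set (A : C -> Prop) : Prop :=
  forall U V : C -> Prop,
    open U -> open V ->
    (forall z, A z -> U z \/ V z) ->
    (exists z, A z /\ U z) ->
    (exists z, A z /\ V z) ->
    exists z, A z /\ U z /\ V z.

Definition planar_domain (A : C -> Prop) : Prop :=
  open A /\ (exists z, A z) /\ connected_set A.

Definition Icc (a b : R) : R -> Prop := fun t => a <= t <= b.

Definition loop_in (A : C -> Prop) (p : C) (g : R -> C) : Prop :=
  continuous_on (Icc 0 1) g /\
  g 0 = p /\ g 1 = p /\
  (forall t, Icc 0 1 t -> A (g t)).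

(** In [H (s, t)], [s] is the deformation parameter and [t] the curve
    parameter; the base point is kept fixed. *)
Definition null_homotopic_in (A : C -> Prop) (p : C) (g : R -> C) : Prop :=
  exists H : R * R -> C,
    continuous_on (fun st : R * R => Icc 0 1 (fst st) /\ Icc 0 1 (snd st)) H /\
    (forall s t, Icc 0 1 s -> Icc 0 1 t -> A (H (s, t))) /\
    (forall t, Icc 0 1 t -> H (0, t) = g t) /\
    (forall t, Icc 0 1 t -> H (1, t) = p) /\
    (forall s, Icc 0 1 s -> H (s, 0) = p /\ H (s, 1) = p).

Definition simply_connected_domain (A : C -> Prop) : Prop :=
  planar_domain A /\
  (forall p g, loop_in A p g -> null_homotopic_in A p g).

(** The length of [g] is the supremum of the lengths of its inscribed polygons.
    Finite subdivisions of [[a, b]] are the initial segments of monotone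
    sequences. *)
Definition rectifiable (a b : R) (g : R -> C) : Prop :=
  exists L : R,
    forall (t : nat -> R) (n : nat),
      (forall i, Icc a b (t i)) ->
      (forall i, t i <= t (S i)) ->
      sum_n (fun i => Cmod (g (t (S i)) - g (t i))%C) n <= L.

Definition closed_rectifiable_curve (a b : R) (g : R -> C) : Prop :=
  a < b /\ continuous_on (Icc a b) g /\ g a = g b /\ rectifiable a b g.

(** Sum of [F (g xi_i) * (g t_(i+1) - g t_i)] over a tagged subdivision: the
    analogue of [Riemann_sum] for the differential of [g]. *)
Definition curve_sum (F : C -> C) (g : R -> C) (ptd : @SF_seq R) : C :=
  seq.foldr Cplus (RtoC 0)
    (seq.pairmap
       (fun x y : R * R => (F (g (snd y)) * (g (fst y) - g (fst x)))%C)
       (SF_h ptd, 0) (SF_t ptd)).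

Definition is_CurveInt (F : C -> C) (g : R -> C) (a b : R) (I : C) : Prop :=
  filterlim (curve_sum F g) (Riemann_fine a b) (locally I).

Definition ex_CurveInt (F : C -> C) (g : R -> C) (a b : R) : Prop :=
  exists I, is_CurveInt F g a b I.

Definition CurveInt (F : C -> C) (g : R -> C) (a b : R) : C :=
  @iota C_R_CompleteNormedModule (is_CurveInt F g a b).

Lemma is_CurveInt_unique (F : C -> C) (g : R -> C) (a b : R) (I : C) :
  is_CurveInt F g a b I -> CurveInt F g a b = I.
Proof.
  intros HI.
  exact (@iota_filterlim_locally _ C_R_CompleteNormedModule _ _
           (Proper_StrongProper _ (Riemann_fine_filter a b)) _ I HI).
Qed.

Definition d_x (F : C -> C) (z : C) : C :=
  (Derive (fun x => Re (F (x, Im z))) (Re z),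
   Derive (fun x => Im (F (x, Im z))) (Re z)).

Definition d_y (F : C -> C) (z : C) : C :=
  (Derive (fun y => Re (F (Re z, y))) (Im z),
   Derive (fun y => Im (F (Re z, y))) (Im z)).

(** No factor [1/2] in either operator, so that [d_z (d_zbar F)] is the
    Laplacian of [F]. *)
Definition d_zbar (F : C -> C) (z : C) : C := (d_x F z + Ci * d_y F z)%C.
Definition d_z (F : C -> C) (z : C) : C := (d_x F z - Ci * d_y F z)%C.

(** [ex_diff_n _ 2] asks for the partial derivatives of order at most two at
    the point and for their (joint) continuity there. *)
Definition C2_on (A : C -> Prop) (f : C -> R) : Prop :=
  forall z, A z -> ex_diff_n (fun x y => f (x, y)) 2 (Re z) (Im z).

Definition schrodinger_solution (A : C -> Prop) (u f : C -> R) : Prop :=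
  C2_on A f /\
  forall z, A z ->
    (- d_z (d_zbar (fun w => RtoC (f w))) z + RtoC (u z) * RtoC (f z))%C
    = RtoC 0.

Definition nonvanishing_on (A : C -> Prop) (f : C -> R) : Prop :=
  forall z, A z -> f z <> 0.

(* Main.v *)
Require Import Defs.
From Stdlib Require Import Reals Lra Lia Classical IndefiniteDescription.
From Coquelicot Require Import Coquelicot.
Open Scope R_scope.

(** Write [w = f1 / f0]. As [w] is real, [d_z w = w_x - i w_y], hence
    [Re (d_z w dz) = w_x dx + w_y dy = dw] is exact, and
    [Im (f0^2 d_z w dz) = f0^2 (w_x dy - w_y dx)] is the flux form of the field
    [f0^2 grad w = f0 grad f1 - f1 grad f0]. The divergence of that field is
    [f0 Lap f1 - f1 Lap f0], and it is zero because [f0] and [f1] satisfy the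
    same equation [Lap f = u f]: the second form is closed
    ([wronskian_form_local_potential]). So only two facts about real forms
    [P dx + Q dy] remain: that they can be integrated along rectifiable curves,
    and that the integral of a closed form over a null-homotopic curve is zero.

    Existence. A rectifiable curve has coordinates whose increments are
    dominated by those of one nondecreasing function [v], the length of the arc
    ([rectifiable_variation]). A Stieltjes integral of a continuous function
    against such a coordinate exists by the Cauchy criterion ([ex_stieltjes]).
    Two subdivisions are compared without a common refinement: the sum over one
    of them, with the integrator clamped to a window [[x, y]], is an additive
    function of the window, close to a single term of the other sum.

    Vanishing. The values of a primitive on squares are recorded by one
    function [E z w], equal to the increment of any primitive on any square of
    the domain that contains [z] and [w] ([local_potential]); for the closed
    form, [E z w] is the integral over the two sides of a right angle from [z]
    to [w]. The sum of [E] along the vertices of a subdivision does not change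
    when the curve is moved a little, because around each cell of the homotopy
    the four increments cancel; it is zero for the constant curve, so
    it is zero for every fine subdivision of the given loop
    ([loop_potential_sums_vanish]). The mean value theorem on a square
    bounds the difference between this sum and the integral sum by the
    oscillation of the coefficients times the length
    ([form_sums_close_to_potential]), so the integral is zero. *)

(** * Length as a dominating function *)

Lemma Cmod_bounds (z w : C) (m : R) :
  Cmod (w - z)%C <= m -> Rabs (Re w - Re z) <= m /\ Rabs (Im w - Im z) <= m.
Proof.
  intros H.
  pose proof (Rmax_Cmod (w - z)%C) as Hm.
  destruct z as [x y], w as [x' y']; cbn in Hm |- *.
  pose proof (Rmax_l (Rabs (x' + - x)) (Rabs (y' + - y))).
  pose proof (Rmax_r (Rabs (x' + - x)) (Rabs (y' + - y))).
  split; unfold Rminus; lra.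
Qed.

Definition dominated_by (a b : R) (v X : R -> R) : Prop :=
  forall x y, a <= x -> x <= y -> y <= b -> Rabs (X y - X x) <= v y - v x.

(** [v x] is the supremum of the lengths of the polygons inscribed in the arc
    over [[a, x]]. Adding the vertices [x] and [y] at the end of such a polygon
    gives one inscribed in the arc over [[a, y]], which is longer by at
    least the chord from [x] to [y]. *)
Lemma rectifiable_variation (a b : R) (g : R -> C) :
  rectifiable a b g ->
  exists v : R -> R,
    dominated_by a b v (fun t => Re (g t)) /\
    dominated_by a b v (fun t => Im (g t)).
Proof.
  intros [L HL].
  pose (lengths := fun x s => exists (t : nat -> R) (n : nat),
    (forall i, Icc a x (t i)) /\ (forall i, t i <= t (S i)) /\
    s = sum_n (fun i => Cmod (g (t (S i)) - g (t i))%C) n).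
  assert (Hlub : forall x, a <= x -> x <= b ->
            is_lub_Rbar (lengths x) (Finite (real (Lub_Rbar (lengths x))))).
  { intros x Hax Hxb.
    pose proof (Lub_Rbar_correct (lengths x)) as H.
    destruct (Lub_Rbar (lengths x)) as [r| |] eqn:E; try exact H; exfalso.
    - destruct H as [_ H]. apply (H (Finite L)).
      intros s [t [n [Ht [Hm ->]]]]. apply HL; trivial.
      intros i; specialize (Ht i); unfold Icc in *; lra.
    - destruct H as [H _].
      specialize (H (sum_n (fun i => Cmod (g a - g a)%C) 0%nat)).
      apply H. exists (fun _ => a), 0%nat. repeat split; intros; lra. }
  assert (Hv : forall x y, a <= x -> x <= y -> y <= b ->
            Cmod (g y - g x)%C
            <= real (Lub_Rbar (lengths y)) - real (Lub_Rbar (lengths x))).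
  { intros x y Hax Hxy Hyb.
    destruct (Hlub x Hax ltac:(lra)) as [_ Hx].
    destruct (Hlub y ltac:(lra) Hyb) as [Hy _].
    enough (Rbar_le (real (Lub_Rbar (lengths x)))
              (real (Lub_Rbar (lengths y)) - Cmod (g y - g x)%C)) by (cbn in *; lra).
    apply Hx. intros s [t [n [Ht [Hm ->]]]]. cbn [Rbar_le].
    (* The polygon of [n] has [n + 2] vertices; [x] then has index [n + 2] and
       [y] every later index. The step from the last vertex to [x] only adds
       length. *)
    pose (t' := fun i => if Nat.leb i (S n) then t i
                         else if Nat.eqb i (n + 2) then x else y).
    assert (Hle : forall i, (i <= S n)%nat -> t' i = t i).
    { intros i Hi. unfold t'. now apply Nat.leb_le in Hi as ->. }
    assert (Hx' : t' (n + 2)%nat = x).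
    { unfold t'. rewrite Nat.eqb_refl.
      now replace (Nat.leb (n + 2) (S n)) with false
        by (symmetry; apply Nat.leb_gt; lia). }
    assert (Hgt : forall i, (n + 2 < i)%nat -> t' i = y).
    { intros i Hi. unfold t'.
      replace (Nat.leb i (S n)) with false
        by (symmetry; apply Nat.leb_gt; lia).
      now replace (Nat.eqb i (n + 2)) with false
        by (symmetry; apply Nat.eqb_neq; lia). }
    assert (HS : lengths y (sum_n (fun i => Cmod (g (t' (S i)) - g (t' i))%C)
                        (S (S n)))).
    { exists t', (S (S n)). split; [|split]; trivial.
      - intros i. destruct (Nat.le_gt_cases i (S n)) as [Hi|Hi].
        + rewrite Hle by trivial. specialize (Ht i). unfold Icc in *; lra.
        + destruct (Nat.eq_dec i (n + 2)) as [->|Hn].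
          * rewrite Hx'. unfold Icc; lra.
          * rewrite Hgt by lia. unfold Icc; lra.
      - intros i. destruct (Nat.le_gt_cases (S i) (S n)).
        + rewrite !Hle by lia. apply Hm.
        + destruct (Nat.eq_dec i (S n)) as [->|Hn].
          * rewrite Hle by lia.
            replace (S (S n)) with (n + 2)%nat by lia.
            rewrite Hx'. apply Ht.
          * rewrite (Hgt (S i)) by lia.
            destruct (Nat.eq_dec i (n + 2)) as [->|Hn'].
            -- now rewrite Hx'.
            -- rewrite Hgt by lia. lra. }
    specialize (Hy _ HS). cbn [Rbar_le] in Hy.
    rewrite !sum_Sn in Hy.
    repeat change (@plus _ ?x ?y) with (Rplus x y) in Hy. cbv beta in Hy.
    rewrite (Hgt (S (S (S n)))) in Hy by lia.
    replace (S (S n)) with (n + 2)%nat in Hy by lia.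
    rewrite Hx' in Hy.
    rewrite (sum_n_ext_loc _ (fun i => Cmod (g (t (S i)) - g (t i))%C))
      in Hy by (intros i Hi; rewrite !Hle by lia; reflexivity).
    pose proof (Cmod_ge_0 (g x - g (t' (S n)))%C).
    lra. }
  exists (fun x => real (Lub_Rbar (lengths x))).
  split; intros x y H1 H2 H3;
    destruct (Cmod_bounds _ _ _ (Hv x y H1 H2 H3)); assumption.
Qed.

(** * Sums over tagged subdivisions *)

(** A tagged subdivision is handled as its first point and the list of the
    pairs of a right end point and a tag, so that proofs go by induction on the
    list. *)
Fixpoint chain_sum (e : R -> R -> R -> R) (x : R) (l : list (R * R)) : R :=
  match l with
  | nil => 0
  | cons (y, xi) l' => e x y xi + chain_sum e y l'
  end.

Fixpoint chain_end (x : R) (l : list (R * R)) : R :=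
  match l with
  | nil => x
  | cons (y, _) l' => chain_end y l'
  end.

Fixpoint fine_chain (d x : R) (l : list (R * R)) : Prop :=
  match l with
  | nil => True
  | cons (y, xi) l' => x <= xi <= y /\ y - x < d /\ fine_chain d y l'
  end.

Definition fine_subdivision (d a b : R) (ptd : @SF_seq R) : Prop :=
  SF_h ptd = a /\ chain_end a (SF_t ptd) = b /\ fine_chain d a (SF_t ptd).

Lemma Riemann_fine_subdivision (a b d : R) :
  a < b -> 0 < d -> Riemann_fine a b (fine_subdivision d a b).
Proof.
  intros Hab Hd. exists (mkposreal d Hd). intros [h l] Hstep [Hps [Hh Hl]].
  rewrite Rmin_left in Hh by lra. rewrite Rmax_right in Hl by lra.
  cbn [SF_h SF_t] in *. subst h. split; [reflexivity|]. cbn [SF_t].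
  clear Hab. revert a Hstep Hps Hl.
  induction l as [|[y xi] l IH]; intros x Hstep Hps Hl.
  - split; [exact Hl | exact I].
  - unfold seq_step in Hstep; cbn in Hstep.
    pose proof (Rmax_l (Rabs (y - x)) (seq_step (SF_lx (mkSF_seq y l)))) as M1.
    pose proof (Rmax_r (Rabs (y - x)) (seq_step (SF_lx (mkSF_seq y l)))) as M2.
    pose proof (Rle_abs (y - x)).
    unfold seq_step in M1, M2; cbn in M1, M2.
    destruct (IH y) as [He Hf].
    + unfold seq_step; cbn. lra.
    + intros i Hi. apply (Hps (S i)). unfold SF_size in *; cbn in *. lia.
    + exact Hl.
    + cbn. split; [exact He|]. split; [|split; [lra | exact Hf]].
      apply (Hps 0%nat). unfold SF_size; cbn. lia.
Qed.

Lemma fine_chain_le (d : R) (l : list (R * R)) :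
  forall x, fine_chain d x l -> x <= chain_end x l.
Proof.
  induction l as [|[y xi] l IH]; intros x H; cbn in *.
  - lra.
  - destruct H as [H1 [_ H3]]. specialize (IH y H3). lra.
Qed.

(** This is where rectifiability enters every estimate: local errors
    proportional to the increments of [v] add up to a multiple of the total
    increment, however many links there are. *)
Lemma chain_sum_close (a b d eps : R) (v : R -> R) (e e' : R -> R -> R -> R) :
  (forall x y xi, a <= x -> x <= xi <= y -> y <= b -> y - x < d ->
     Rabs (e x y xi - e' x y xi) <= eps * (v y - v x)) ->
  forall l x, fine_chain d x l -> a <= x -> chain_end x l <= b ->
  Rabs (chain_sum e x l - chain_sum e' x l) <= eps * (v (chain_end x l) - v x).
Proof.
  intros H l. induction l as [|[y xi] l IH]; intros x Hf Hx He; cbn in *.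
  - rewrite !Rminus_diag, Rabs_R0. lra.
  - destruct Hf as [H1 [H2 H3]].
    pose proof (fine_chain_le _ _ _ H3).
    specialize (IH y H3 ltac:(lra) He).
    specialize (H x y xi Hx H1 ltac:(lra) H2).
    replace (e x y xi + chain_sum e y l - (e' x y xi + chain_sum e' y l))
      with ((e x y xi - e' x y xi) + (chain_sum e y l - chain_sum e' y l)) by ring.
    eapply Rle_trans; [apply Rabs_triang|]. lra.
Qed.

Lemma chain_sum_telescope (f : R -> R) (l : list (R * R)) :
  forall x, chain_sum (fun s t _ => f t - f s) x l = f (chain_end x l) - f x.
Proof.
  induction l as [|[y xi] l IH]; intros x; cbn.
  - ring.
  - rewrite IH. ring.
Qed.

Lemma chain_sum_plus (e e' : R -> R -> R -> R) (l : list (R * R)) :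
  forall x, chain_sum (fun s t xi => e s t xi + e' s t xi) x l
            = chain_sum e x l + chain_sum e' x l.
Proof.
  induction l as [|[y xi] l IH]; intros x; cbn; [ring | rewrite IH; ring].
Qed.

Lemma chain_sum_ext (a b d : R) (e e' : R -> R -> R -> R) :
  (forall x y xi, a <= x -> x <= xi <= y -> y <= b -> e x y xi = e' x y xi) ->
  forall l x, fine_chain d x l -> a <= x -> chain_end x l <= b ->
  chain_sum e x l = chain_sum e' x l.
Proof.
  intros H l. induction l as [|[y xi] l IH]; intros x Hf Hx He; cbn in *.
  - reflexivity.
  - destruct Hf as [H1 [H2 H3]].
    pose proof (fine_chain_le _ _ _ H3).
    rewrite H, IH; trivial; lra.
Qed.

(** * Riemann-Stieltjes integrals *)

Definition link (p X : R -> R) (x y xi : R) : R := p xi * (X y - X x).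

Definition clamp (x y s : R) : R := Rmax x (Rmin s y).

Lemma clamp_mono (x y s t : R) : s <= t -> clamp x y s <= clamp x y t.
Proof.
  intros H. unfold clamp. apply Rle_max_compat_l, Rle_min_compat_r, H.
Qed.

Lemma clamp_bounds (x y s : R) : x <= y -> x <= clamp x y s <= y.
Proof.
  intros H. unfold clamp. split; [apply Rmax_l|].
  apply Rmax_lub; [exact H | apply Rmin_r].
Qed.

Lemma clamp_id (x y s : R) : x <= s -> s <= y -> clamp x y s = s.
Proof.
  intros H1 H2. unfold clamp. rewrite Rmin_left, Rmax_right; trivial.
Qed.

Lemma clamp_below (x y s : R) : s <= x -> x <= y -> clamp x y s = x.
Proof.
  intros H1 H2. unfold clamp.
  rewrite Rmin_left, Rmax_left; trivial; lra.
Qed.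

Lemma clamp_above (x y s : R) : y <= s -> x <= y -> clamp x y s = y.
Proof.
  intros H1 H2. unfold clamp. rewrite Rmin_right, Rmax_right; trivial.
Qed.

(** The part of the Stieltjes sum over [l] that comes from [[x, y]]: clamping
    cuts the links at [x] and [y] and kills those outside, which replaces the
    common refinement of two subdivisions. *)
Definition window_sum (p X : R -> R) (l : list (R * R)) (a x y : R) : R :=
  chain_sum (link p (fun s => X (clamp x y s))) a l.

(** Both sides are equal link by link, because
    [X (clamp x z s) = X (clamp x y s) + X (clamp y z s) - X y] for each [s]. *)
Lemma window_sum_chasles (p X : R -> R) (x y z : R) (l : list (R * R)) :
  x <= y -> y <= z -> forall a,
  window_sum p X l a x z = window_sum p X l a x y + window_sum p X l a y z.
Proof.
  intros Hxy Hyz a. unfold window_sum. rewrite <- chain_sum_plus.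
  revert a. induction l as [|[t xi] l IH]; intros a; cbn; [reflexivity|].
  assert (H : forall s, X (clamp x z s)
                        = X (clamp x y s) + X (clamp y z s) - X y).
  { intros s. destruct (Rle_dec s y) as [Hs|Hs].
    - rewrite (clamp_below y z s) by trivial.
      unfold clamp. rewrite (Rmin_left s z), (Rmin_left s y) by lra. ring.
    - rewrite (clamp_above x y s) by lra.
      replace (clamp x z s) with (clamp y z s); [ring|].
      unfold clamp. destruct (Rle_dec s z).
      + rewrite Rmin_left, !Rmax_right; lra.
      + rewrite Rmin_right, !Rmax_right; lra. }
  rewrite IH. unfold link. rewrite !H. ring.
Qed.

Lemma window_sums_telescope (p X : R -> R) (l : list (R * R)) (a d : R) :
  forall m x, fine_chain d x m ->
  chain_sum (fun s t _ => window_sum p X l a s t) x m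
  = window_sum p X l a x (chain_end x m).
Proof.
  induction m as [|[y xi] m IH]; intros x Hf; cbn in *.
  - unfold window_sum. clear Hf. revert a.
    induction l as [|[y xi] l IH]; intros a; cbn; [reflexivity|].
    rewrite <- IH. unfold link.
    assert (H : forall s, clamp x x s = x).
    { intros s. pose proof (clamp_bounds x x s (Rle_refl x)). lra. }
    rewrite !H. ring.
  - destruct Hf as [H1 [_ H3]]. pose proof (fine_chain_le _ _ _ H3).
    rewrite IH by trivial. symmetry. apply window_sum_chasles; lra.
Qed.

(** A link of [l] that meets [[x, y]] has its tag within [2 * d] of [xi], so its
    [p] may be replaced by [p xi] at the cost of [eps] times the increment of
    [v]; a link that does not meet [[x, y]] contributes nothing to either
    side. *)
Lemma window_sum_close (a b d eps : R) (v p X : R -> R) :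
  dominated_by a b v X ->
  (forall s t, a <= s <= b -> a <= t <= b -> Rabs (s - t) < 2 * d ->
     Rabs (p s - p t) <= eps) ->
  forall x y xi, a <= x -> x <= xi <= y -> y <= b -> y - x < d ->
  forall l s, fine_chain d s l -> a <= s -> chain_end s l <= b ->
  Rabs (p xi * (X (clamp x y (chain_end s l)) - X (clamp x y s))
        - window_sum p X l s x y)
  <= eps * (v (clamp x y (chain_end s l)) - v (clamp x y s)).
Proof.
  intros Hv Hp x y xi Hax Hxi Hyb Hd l. unfold window_sum.
  induction l as [|[t eta] l IH]; intros s Hf Has He; cbn in *.
  - rewrite !Rminus_diag, Rmult_0_r, Rminus_diag, Rabs_R0. lra.
  - destruct Hf as [H1 [H2 H3]]. pose proof (fine_chain_le _ _ _ H3).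
    specialize (IH t H3 ltac:(lra) He).
    (* Replacing the tag in one link: the first two cases are links outside the
       window. *)
    assert (Hlink : Rabs ((p xi - p eta) * (X (clamp x y t) - X (clamp x y s)))
                    <= eps * (v (clamp x y t) - v (clamp x y s))).
    { destruct (Rle_dec y s) as [Hys|Hys].
      { rewrite !clamp_above by lra.
        rewrite !Rminus_diag, !Rmult_0_r, Rabs_R0. lra. }
      destruct (Rle_dec t x) as [Htx|Htx].
      { rewrite !clamp_below by lra.
        rewrite !Rminus_diag, !Rmult_0_r, Rabs_R0. lra. }
      rewrite Rabs_mult.
      apply Rmult_le_compat; try apply Rabs_pos.
      - apply Hp; try lra. apply Rabs_def1; lra.
      - pose proof (clamp_bounds x y s ltac:(lra)).
        pose proof (clamp_bounds x y t ltac:(lra)).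
        pose proof (clamp_mono x y s t ltac:(lra)).
        apply Hv; lra. }
    set (E := X (clamp x y (chain_end t l))) in *.
    set (W := chain_sum _ t l) in *.
    unfold link at 1.
    replace (p xi * (E - X (clamp x y s))
             - (p eta * (X (clamp x y t) - X (clamp x y s)) + W))
      with ((p xi - p eta) * (X (clamp x y t) - X (clamp x y s))
            + (p xi * (E - X (clamp x y t)) - W)) by ring.
    eapply Rle_trans; [apply Rabs_triang|]. lra.
Qed.

(** The sum over [m] is the sum of its windows over the links of [l], and each
    window is close to the corresponding term of the sum over [l]. *)
Lemma link_sums_close (a b d eps : R) (v p X : R -> R) :
  dominated_by a b v X ->
  (forall s t, a <= s <= b -> a <= t <= b -> Rabs (s - t) < 2 * d ->
     Rabs (p s - p t) <= eps) ->
  forall l m, fine_chain d a l -> chain_end a l = b ->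
  fine_chain d a m -> chain_end a m = b ->
  Rabs (chain_sum (link p X) a l - chain_sum (link p X) a m)
  <= eps * (v b - v a).
Proof.
  intros Hv Hp l m Hl Hle Hm Hme.
  pose proof (fine_chain_le _ _ _ Hl) as Hab. rewrite Hle in Hab.
  replace (chain_sum (link p X) a m) with (window_sum p X m a a b).
  2:{ unfold window_sum. apply (chain_sum_ext a b d); trivial; try lra.
      intros x y xi Hx Hxi Hy. unfold link. rewrite !clamp_id; trivial; lra. }
  rewrite <- Hle at 1.
  rewrite <- (window_sums_telescope p X m a d l a Hl).
  rewrite <- Hle at 1.
  apply (chain_sum_close a b d); trivial; try lra.
  intros x y xi Hx Hxi Hy Hd. unfold link.
  pose proof (window_sum_close a b d eps v p X Hv Hp x y xi Hx Hxi Hy Hd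
                m a Hm (Rle_refl a) ltac:(lra)) as H.
  rewrite Hme, (clamp_above x y b), (clamp_below x y a) in H by lra.
  exact H.
Qed.

Definition uniformly_continuous_on (a b : R) (p : R -> R) : Prop :=
  forall eps, 0 < eps -> exists d, 0 < d /\
    forall s t, a <= s <= b -> a <= t <= b -> Rabs (s - t) < d ->
    Rabs (p s - p t) <= eps.

Definition link_sum (p X : R -> R) (ptd : @SF_seq R) : R :=
  chain_sum (link p X) (SF_h ptd) (SF_t ptd).

Theorem ex_stieltjes (a b : R) (v p X : R -> R) :
  a < b -> dominated_by a b v X -> uniformly_continuous_on a b p ->
  exists I : R, filterlim (link_sum p X) (Riemann_fine a b) (locally I).
Proof.
  intros Hab Hv Hp.
  apply (filterlim_locally_cauchy (U := R_CompleteSpace) (F := Riemann_fine a b)).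
  intros eps.
  assert (HV : 0 <= v b - v a).
  { eapply Rle_trans; [apply Rabs_pos | apply (Hv a b); lra]. }
  assert (Heps : 0 < eps / (v b - v a + 1)).
  { apply Rdiv_lt_0_compat; [apply cond_pos | lra]. }
  destruct (Hp _ Heps) as [d [Hd Hosc]].
  exists (fine_subdivision (d / 2) a b).
  split; [apply Riemann_fine_subdivision; lra|].
  intros [h l] [h' m] [Hh [Hle Hl]] [Hh' [Hme Hm]].
  cbn in Hh, Hle, Hl, Hh', Hme, Hm. subst h h'.
  unfold link_sum. cbn [SF_h SF_t].
  change (Rabs (chain_sum (link p X) a m - chain_sum (link p X) a l) < eps).
  eapply Rle_lt_trans.
  - apply (link_sums_close a b (d / 2) (eps / (v b - v a + 1)) v); trivial.
    intros s t Hs Ht Hst. apply Hosc; trivial. lra.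
  - replace (eps / (v b - v a + 1) * (v b - v a))
      with (eps - eps / (v b - v a + 1)) by (field; lra).
    lra.
Qed.

(** * Squares of the plane *)

Lemma ball_square (c z : C) (r : R) :
  ball c r z <-> Rabs (Re z - Re c) < r /\ Rabs (Im z - Im c) < r.
Proof. reflexivity. Qed.

Lemma open_square (c : C) (r : R) : open (ball c r).
Proof.
  intros z Hz. destruct (proj1 (ball_square c z r) Hz) as [H1 H2].
  assert (He : 0 < Rmin (r - Rabs (Re z - Re c)) (r - Rabs (Im z - Im c)))
    by (apply Rmin_glb_lt; lra).
  pose proof (Rmin_l (r - Rabs (Re z - Re c)) (r - Rabs (Im z - Im c))).
  pose proof (Rmin_r (r - Rabs (Re z - Re c)) (r - Rabs (Im z - Im c))).
  set (e := Rmin _ _) in *.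
  exists (mkposreal e He). intros w Hw.
  change (Rabs (Re w - Re z) < e /\ Rabs (Im w - Im z) < e) in Hw.
  destruct Hw as [G1 G2]. apply (proj2 (ball_square c w r)). split.
  - replace (Re w - Re c) with ((Re w - Re z) + (Re z - Re c)) by ring.
    eapply Rle_lt_trans; [apply Rabs_triang|]. lra.
  - replace (Im w - Im c) with ((Im w - Im z) + (Im z - Im c)) by ring.
    eapply Rle_lt_trans; [apply Rabs_triang|]. lra.
Qed.

Lemma ball_horizontal_side (c z w : C) (r s : R) :
  ball c r z -> ball c r w -> Rmin (Re z) (Re w) <= s <= Rmax (Re z) (Re w) ->
  ball c r (s, Im z).
Proof.
  rewrite !ball_square. cbn [Re Im fst snd].
  intros [H1 H1'] [H2 _] Hs. split; [|exact H1'].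
  apply Rabs_def2 in H1. apply Rabs_def2 in H2.
  unfold Rmin, Rmax in Hs. destruct (Rle_dec (Re z) (Re w)); apply Rabs_def1; lra.
Qed.

Lemma ball_vertical_side (c z w : C) (r s : R) :
  ball c r z -> ball c r w -> Rmin (Im z) (Im w) <= s <= Rmax (Im z) (Im w) ->
  ball c r (Re w, s).
Proof.
  rewrite !ball_square. cbn [Re Im fst snd].
  intros [_ H1] [H2' H2] Hs. split; [exact H2'|].
  apply Rabs_def2 in H1. apply Rabs_def2 in H2.
  unfold Rmin, Rmax in Hs. destruct (Rle_dec (Im z) (Im w)); apply Rabs_def1; lra.
Qed.

Lemma ball_corner (c z w : C) (r : R) :
  ball c r z -> ball c r w -> ball c r (Re w, Im z).
Proof.
  intros Hz Hw. apply (ball_horizontal_side c z w); trivial.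
  split; [apply Rmin_r | apply Rmax_r].
Qed.

(** Balls of [C] are open squares for the product uniform structure
    ([ball_square]). *)
Definition local_property (A : C -> Prop) (good : C -> posreal -> Prop) : Prop :=
  forall z, A z -> exists r, good z r.

Definition rectangle (a b a' b' : R) : R * R -> Prop :=
  fun st => Icc a b (fst st) /\ Icc a' b' (snd st).

(** Compactness of the parameter rectangle is used for any property that
    small squares around points of [A] have, so that the homotopy and the
    curve are covered by the same argument. *)
Lemma lebesgue_number (A : C -> Prop) (good : C -> posreal -> Prop)
    (a b a' b' : R) (H : R * R -> C) :
  local_property A good ->
  continuous_on (rectangle a b a' b') H ->
  (forall s t, Icc a b s -> Icc a' b' t -> A (H (s, t))) ->
  exists d, 0 < d /\ forall s t, Icc a b s -> Icc a' b' t ->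
    exists c r, good c r /\
      forall s' t', Icc a b s' -> Icc a' b' t' ->
        Rabs (s' - s) < d -> Rabs (t' - t) < d -> ball c r (H (s', t')).
Proof.
  intros Hgood Hcont HA.
  (* The factor 2 leaves room for the distance from a point of the rectangle
     to the centre that compactness provides for it. *)
  pose (near := fun st (e : posreal) c r => good c r /\
          forall s' t', Icc a b s' -> Icc a' b' t' ->
            Rabs (s' - fst st) < 2 * e -> Rabs (t' - snd st) < 2 * e ->
            ball c (pos r) (H (s', t'))).
  assert (Hgauge : forall st : R * R, exists e : posreal,
            rectangle a b a' b' st -> exists c r, near st e c r).
  { intros [s t].
    destruct (classic (rectangle a b a' b' (s, t))) as [Hst|Hst].
    2:{ exists (mkposreal 1 Rlt_0_1). intros; contradiction. }
    destruct (Hgood (H (s, t)) (HA s t (proj1 Hst) (proj2 Hst))) as [r Hr].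
    specialize (Hcont (s, t) Hst (ball (H (s, t)) r) (locally_ball _ r)).
    destruct Hcont as [e He].
    assert (He2 : 0 < e / 2) by (pose proof (cond_pos e); lra).
    exists (mkposreal _ He2). intros _. exists (H (s, t)), r.
    split; [exact Hr|]. intros s' t' Hs' Ht' H1 H2. cbn in H1, H2.
    apply He; [|split; assumption].
    split; [change (Rabs (s' - s) < e) | change (Rabs (t' - t) < e)]; lra. }
  apply functional_choice in Hgauge. destruct Hgauge as [gauge Hgauge].
  destruct (compactness_value_2d a b a' b' (fun s t => gauge (s, t))) as [d Hd].
  exists d. split; [apply cond_pos|]. intros s t Hs Ht.
  apply NNPP. intros Hn. apply (Hd s t Hs Ht).
  intros [u [v [Hu [Hv [Hsu [Htv Hdd]]]]]]. apply Hn.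
  destruct (Hgauge (u, v) (conj Hu Hv)) as [c [r [Hcr Hball]]].
  exists c, r. split; [exact Hcr|]. intros s' t' Hs' Ht' H1 H2.
  apply Hball; trivial; cbn [fst snd].
  - replace (s' - u) with ((s' - s) + (s - u)) by ring.
    eapply Rle_lt_trans; [apply Rabs_triang|]. lra.
  - replace (t' - v) with ((t' - t) + (t - v)) by ring.
    eapply Rle_lt_trans; [apply Rabs_triang|]. lra.
Qed.

Lemma continuous_on_comp {T U V : UniformSpace} (A : T -> Prop) (B : U -> Prop)
    (h : T -> U) (f : U -> V) :
  continuous_on B f -> (forall x, A x -> continuous h x) ->
  (forall x, A x -> B (h x)) -> continuous_on A (fun x => f (h x)).
Proof.
  intros Hf Hh HAB x Hx P HP.
  specialize (Hf (h x) (HAB x Hx) P HP).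
  specialize (Hh x Hx _ Hf).
  unfold filtermap, within in *.
  revert Hh. apply filter_imp. intros y Hy HAy. apply Hy, HAB, HAy.
Qed.

Lemma lebesgue_number_path (A : C -> Prop) (good : C -> posreal -> Prop)
    (a b : R) (g : R -> C) :
  local_property A good -> continuous_on (Icc a b) g ->
  (forall t, Icc a b t -> A (g t)) ->
  exists d, 0 < d /\ forall t, Icc a b t -> exists c r, good c r /\
    forall t', Icc a b t' -> Rabs (t' - t) < d -> ball c r (g t').
Proof.
  intros Hgood Hg HA.
  destruct (lebesgue_number A good 0 1 a b (fun st => g (snd st)))
    as [d [Hd Hl]]; trivial.
  - apply (continuous_on_comp _ (Icc a b) snd g); trivial.
    + intros [s t] _. apply continuous_snd.
    + intros st [_ H]. exact H.
  - intros s t _ Ht. apply HA, Ht.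
  - exists d. split; [exact Hd|]. intros t Ht.
    assert (H0 : Icc 0 1 0) by (unfold Icc; lra).
    destruct (Hl 0 t H0 Ht) as [c [r [Hcr Hb]]].
    exists c, r. split; [exact Hcr|]. intros t' Ht' Htt.
    apply (Hb 0 t'); trivial. rewrite Rminus_diag, Rabs_R0. exact Hd.
Qed.

Definition small_oscillation (P : C -> R) (eps : R) (c : C) (r : posreal) : Prop :=
  forall z w, ball c r z -> ball c r w -> Rabs (P z - P w) <= eps.

Lemma continuous_small_oscillation (A : C -> Prop) (P : C -> R) (eps : R) :
  0 < eps -> (forall z, A z -> continuous P z) ->
  local_property A (small_oscillation P eps).
Proof.
  intros He HP z Hz.
  assert (He2 : 0 < eps / 2) by lra.
  destruct (HP z Hz _ (locally_ball (P z) (mkposreal _ He2))) as [r Hr].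
  exists r. intros w w' Hw Hw'.
  apply Hr in Hw. apply Hr in Hw'.
  change (Rabs (P w - P z) < eps / 2) in Hw.
  change (Rabs (P w' - P z) < eps / 2) in Hw'.
  replace (P w - P w') with ((P w - P z) - (P w' - P z)) by ring.
  eapply Rle_trans; [apply Rabs_triang|]. rewrite Rabs_Ropp. lra.
Qed.

Lemma uniformly_continuous_along (A : C -> Prop) (P : C -> R) (a b : R) (g : R -> C) :
  (forall z, A z -> continuous P z) -> continuous_on (Icc a b) g ->
  (forall t, Icc a b t -> A (g t)) ->
  uniformly_continuous_on a b (fun t => P (g t)).
Proof.
  intros HP Hg HA eps He.
  destruct (lebesgue_number_path A _ a b g
              (continuous_small_oscillation A P eps He HP) Hg HA) as [d [Hd Hl]].
  exists d. split; [exact Hd|]. intros s t Hs Ht Hst.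
  destruct (Hl t Ht) as [c [r [Hosc Hb]]].
  apply Hosc; apply Hb; trivial. rewrite Rminus_diag, Rabs_R0. exact Hd.
Qed.

(** * Local primitives of differential forms *)

Definition has_partials_on (B : C -> Prop) (Phi P Q : C -> R) : Prop :=
  forall x y, B (x, y) ->
    is_derive (fun x' => Phi (x', y)) x (P (x, y)) /\
    is_derive (fun y' => Phi (x, y')) y (Q (x, y)).

(** [E z w] is meant for close points only; nothing relates its values on
    points that lie in no common square of [A]. In return it is a single
    function, whereas the primitives [Phi] are tied to a square and defined up
    to a constant. *)
Definition local_potential (A : C -> Prop) (P Q : C -> R) (E : C -> C -> R) : Prop :=
  forall (c : C) (r : posreal), (forall z, ball c r z -> A z) ->
    exists Phi, has_partials_on (ball c r) Phi P Q /\
      forall z w, ball c r z -> ball c r w -> E z w = Phi w - Phi z.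

(** Mean value theorem on the horizontal and on the vertical side of a right
    angle from [z] to [w]: both intermediate points lie in the square, where
    the coefficients are close to their values at [zeta]. *)
Lemma increment_close (P Q Phi : C -> R) (c : C) (r : posreal) (eps : R) :
  has_partials_on (ball c r) Phi P Q ->
  small_oscillation P eps c r -> small_oscillation Q eps c r ->
  forall zeta z w, ball c r zeta -> ball c r z -> ball c r w ->
  Rabs (P zeta * (Re w - Re z) + Q zeta * (Im w - Im z) - (Phi w - Phi z))
  <= eps * (Rabs (Re w - Re z) + Rabs (Im w - Im z)).
Proof.
  intros HPhi HP HQ zeta z w Hzeta Hz Hw.
  destruct (MVT_gen (fun x => Phi (x, Im z)) (Re z) (Re w)
              (fun x => P (x, Im z))) as [s [Hs Es]].
  { intros x Hx. apply HPhi, (ball_horizontal_side c z w); trivial. lra. }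
  { intros x Hx. apply continuity_pt_filterlim.
    apply (ex_derive_continuous (fun x => Phi (x, Im z))).
    exists (P (x, Im z)). apply HPhi, (ball_horizontal_side c z w); trivial. }
  destruct (MVT_gen (fun y => Phi (Re w, y)) (Im z) (Im w)
              (fun y => Q (Re w, y))) as [t [Ht Et]].
  { intros y Hy. apply HPhi, (ball_vertical_side c z w); trivial. lra. }
  { intros y Hy. apply continuity_pt_filterlim.
    apply (ex_derive_continuous (fun y => Phi (Re w, y))).
    exists (Q (Re w, y)). apply HPhi, (ball_vertical_side c z w); trivial. }
  specialize (HP zeta (s, Im z) Hzeta (ball_horizontal_side c z w r s Hz Hw Hs)).
  specialize (HQ zeta (Re w, t) Hzeta (ball_vertical_side c z w r t Hz Hw Ht)).
  replace (Phi w) with (Phi (Re w, Im w)) by (destruct w; reflexivity).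
  replace (Phi z) with (Phi (Re z, Im z)) by (destruct z; reflexivity).
  replace (_ - _) with ((P zeta - P (s, Im z)) * (Re w - Re z)
                        + (Q zeta - Q (Re w, t)) * (Im w - Im z)) by lra.
  eapply Rle_trans; [apply Rabs_triang|]. rewrite !Rabs_mult, Rmult_plus_distr_l.
  apply Rplus_le_compat; apply Rmult_le_compat_r; trivial; apply Rabs_pos.
Qed.

Definition form_link (P Q : C -> R) (g : R -> C) (x y xi : R) : R :=
  link (fun t => P (g t)) (fun t => Re (g t)) x y xi
  + link (fun t => Q (g t)) (fun t => Im (g t)) x y xi.

Lemma form_sums_close_to_potential (A : C -> Prop) (P Q : C -> R)
    (E : C -> C -> R) (a b : R) (v : R -> R) (g : R -> C) :
  open A -> (forall z, A z -> continuous P z) ->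
  (forall z, A z -> continuous Q z) ->
  local_potential A P Q E ->
  continuous_on (Icc a b) g -> (forall t, Icc a b t -> A (g t)) ->
  dominated_by a b v (fun t => Re (g t)) ->
  dominated_by a b v (fun t => Im (g t)) ->
  forall eps, 0 < eps -> exists d, 0 < d /\ forall l,
    fine_chain d a l -> chain_end a l = b ->
    Rabs (chain_sum (form_link P Q g) a l
          - chain_sum (fun x y _ => E (g x) (g y)) a l) <= eps * (v b - v a).
Proof.
  intros HA HP HQ HE Hg HgA Hre Him eps Heps.
  assert (He2 : 0 < eps / 2) by lra.
  pose (good := fun c r => (forall z, ball c (pos r) z -> A z) /\
          small_oscillation P (eps / 2) c r /\ small_oscillation Q (eps / 2) c r).
  assert (Hgood : local_property A good).
  { intros z Hz.
    destruct (HA z Hz) as [r1 H1].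
    destruct (continuous_small_oscillation A P (eps / 2) He2 HP z Hz) as [r2 H2].
    destruct (continuous_small_oscillation A Q (eps / 2) He2 HQ z Hz) as [r3 H3].
    assert (Hr : 0 < Rmin r1 (Rmin r2 r3))
      by (repeat apply Rmin_glb_lt; apply cond_pos).
    pose proof (Rmin_l r1 (Rmin r2 r3)). pose proof (Rmin_r r1 (Rmin r2 r3)).
    pose proof (Rmin_l r2 r3). pose proof (Rmin_r r2 r3).
    exists (mkposreal _ Hr). repeat split.
    - intros w Hw. apply H1. revert Hw. apply ball_le; cbn; lra.
    - intros w w' Hw Hw'. apply H2; [revert Hw | revert Hw']; apply ball_le; cbn; lra.
    - intros w w' Hw Hw'. apply H3; [revert Hw | revert Hw']; apply ball_le; cbn; lra. }
  destruct (lebesgue_number_path A good a b g Hgood Hg HgA) as [d [Hd Hl]].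
  exists d. split; [exact Hd|]. intros l Hf Hend.
  pose proof (fine_chain_le _ _ _ Hf) as Hab.
  rewrite <- Hend at 1.
  apply (chain_sum_close a b d); trivial; try lra.
  intros x y xi Hx Hxi Hy Hxy.
  destruct (Hl x) as [c [r [[HcA [HoP HoQ]] Hb]]]; [unfold Icc; lra|].
  destruct (HE c r HcA) as [Phi [HPhi HEPhi]].
  assert (Hin : forall t, x <= t <= y -> ball c r (g t)).
  { intros t Ht. apply Hb; [unfold Icc; lra|]. apply Rabs_def1; lra. }
  rewrite HEPhi by (apply Hin; lra).
  pose proof (increment_close P Q Phi c r (eps / 2) HPhi HoP HoQ
    (g xi) (g x) (g y) (Hin xi Hxi) (Hin x ltac:(lra)) (Hin y ltac:(lra))) as Hinc.
  specialize (Hre x y Hx ltac:(lra) Hy). specialize (Him x y Hx ltac:(lra) Hy).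
  eapply Rle_trans; [exact Hinc|].
  replace (eps * (v y - v x)) with (eps / 2 * ((v y - v x) + (v y - v x))) by field.
  apply Rmult_le_compat_l; lra.
Qed.

(** * Invariance under homotopy *)

(** [h] and [h'] are two neighbouring rows of a homotopy. In each cell the
    increments of a primitive along the lower and right sides add up to those
    along the left and upper sides; summed over the cells, only the two outer
    vertical sides remain. *)
Lemma homotopy_row_step (A : C -> Prop) (P Q : C -> R) (E : C -> C -> R)
    (h h' : R -> C) (a b d : R) :
  local_potential A P Q E ->
  (forall t, Icc a b t -> exists (c : C) (r : posreal),
     (forall z, ball c r z -> A z) /\
     forall t', Icc a b t' -> Rabs (t' - t) < d ->
       ball c r (h t') /\ ball c r (h' t')) ->
  forall l x, fine_chain d x l -> a <= x -> chain_end x l <= b ->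
  chain_sum (fun s t _ => E (h s) (h t)) x l
    + E (h (chain_end x l)) (h' (chain_end x l))
  = E (h x) (h' x) + chain_sum (fun s t _ => E (h' s) (h' t)) x l.
Proof.
  intros HE Hcell l. induction l as [|[y xi] l IH]; intros x Hf Hx Hb; cbn in *.
  - ring.
  - destruct Hf as [H1 [H2 H3]]. pose proof (fine_chain_le _ _ _ H3).
    rewrite Rplus_assoc, IH by (trivial; lra).
    destruct (Hcell x) as [c [r [HA Hball]]]; [unfold Icc; lra|].
    destruct (Hball x) as [B1 B2];
      [unfold Icc; lra | rewrite Rminus_diag, Rabs_R0; lra|].
    destruct (Hball y) as [B3 B4];
      [unfold Icc; lra | apply Rabs_def1; lra|].
    destruct (HE c r HA) as [Phi [_ HPhi]].
    rewrite !HPhi by assumption. ring.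
Qed.

Lemma chain_sum_zero (a b d : R) (e : R -> R -> R -> R) (l : list (R * R)) :
  (forall x y xi, a <= x -> x <= xi <= y -> y <= b -> e x y xi = 0) ->
  fine_chain d a l -> chain_end a l = b -> chain_sum e a l = 0.
Proof.
  intros H Hf He.
  rewrite (chain_sum_ext a b d e (fun x y _ => 0 - 0)); try lra; trivial.
  - rewrite (chain_sum_telescope (fun _ => 0)). ring.
  - intros. rewrite H by lra. ring.
Qed.

(** By the cell argument, the sum over row [k / (N + 1)] of the homotopy does
    not depend on [k], since the two outer sides are constant; the
    last row is constant, so its sum is zero. The subdivision in the curve
    parameter is arbitrary, as long as it is fine. *)
Lemma potential_sums_vanish (A : C -> Prop) (P Q : C -> R) (E : C -> C -> R)
    (a b : R) (p : C) (H : R * R -> C) :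
  a < b -> open A -> local_potential A P Q E ->
  continuous_on (rectangle 0 1 a b) H ->
  (forall s t, Icc 0 1 s -> Icc a b t -> A (H (s, t))) ->
  (forall t, Icc a b t -> H (1, t) = p) ->
  (forall s, Icc 0 1 s -> H (s, a) = p /\ H (s, b) = p) ->
  exists d, 0 < d /\ forall l, fine_chain d a l -> chain_end a l = b ->
    chain_sum (fun x y _ => E (H (0, x)) (H (0, y))) a l = 0.
Proof.
  intros Hab HA HE Hcont HHA H1 Hp.
  assert (HEp : E p p = 0).
  { assert (HAp : A p).
    { rewrite <- (H1 a) by (unfold Icc; lra). apply HHA; unfold Icc; lra. }
    destruct (HA p HAp) as [r Hr].
    destruct (HE p r Hr) as [Phi [_ HPhi]].
    rewrite HPhi by apply ball_center. ring. }
  destruct (lebesgue_number A (fun c r => forall z, ball c (pos r) z -> A z)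
              0 1 a b H) as [d [Hd Hl]]; trivial.
  exists d. split; [exact Hd|]. intros l Hf Hend.
  destruct (nfloor_ex (/ d)) as [N [_ HN]].
  { left. now apply Rinv_0_lt_compat. }
  pose proof (pos_INR N) as HN0.
  assert (Hstep : / (INR N + 1) < d).
  { rewrite <- (Rinv_inv d). apply Rinv_0_lt_contravar; trivial.
    now apply Rinv_0_lt_compat. }
  pose (s := fun k => INR k * / (INR N + 1)).
  assert (Hs01 : forall k, (k <= S N)%nat -> Icc 0 1 (s k)).
  { intros k Hk. apply le_INR in Hk. rewrite S_INR in Hk.
    pose proof (pos_INR k). unfold s, Icc. split.
    - apply Rmult_le_pos; trivial. left. apply Rinv_0_lt_compat. lra.
    - apply Rmult_le_reg_r with (INR N + 1); [lra|].
      rewrite Rmult_assoc, Rinv_l; lra. }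
  assert (Hrows : forall k, (k <= S N)%nat ->
            chain_sum (fun x y _ => E (H (0, x)) (H (0, y))) a l
            = chain_sum (fun x y _ => E (H (s k, x)) (H (s k, y))) a l).
  { induction k as [|k IH]; intros Hk.
    - replace (s 0%nat) with 0 by (unfold s; cbn; ring). reflexivity.
    - rewrite IH by lia.
      assert (Hk1 := Hs01 k ltac:(lia)). assert (Hk2 := Hs01 (S k) Hk).
      pose proof (homotopy_row_step A P Q E (fun t => H (s k, t))
        (fun t => H (s (S k), t)) a b d HE) as Hrow. cbv beta in Hrow.
      specialize (fun G => Hrow G l a Hf (Rle_refl a) (Req_le _ _ Hend)).
      rewrite Hend in Hrow.
      destruct (Hp _ Hk1) as [-> ->] in Hrow.
      destruct (Hp _ Hk2) as [-> ->] in Hrow.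
      rewrite HEp in Hrow.
      rewrite Rplus_0_r, Rplus_0_l in Hrow. apply Hrow. clear Hrow.
      intros t Ht. destruct (Hl (s k) t Hk1 Ht) as [c [r [HcA Hb]]].
      exists c, r. split; [exact HcA|]. intros t' Ht' Htt. split; apply Hb; trivial.
      + rewrite Rminus_diag, Rabs_R0. exact Hd.
      + unfold s. rewrite S_INR.
        replace (_ - _) with (/ (INR N + 1)) by ring.
        rewrite Rabs_pos_eq; trivial. left. apply Rinv_0_lt_compat. lra. }
  rewrite (Hrows (S N) (le_n _)).
  replace (s (S N)) with 1 by (unfold s; rewrite S_INR; field; lra).
  apply (chain_sum_zero a b d); trivial.
  intros x y xi Hx Hxi Hy. rewrite !H1 by (unfold Icc; lra). exact HEp.
Qed.

(** The affine change of parameter from [[0, 1]] to [[a, b]] carries the null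
    homotopy over to the given parametrization. *)
Lemma loop_potential_sums_vanish (A : C -> Prop) (P Q : C -> R) (E : C -> C -> R)
    (a b : R) (g : R -> C) :
  simply_connected_domain A -> local_potential A P Q E ->
  a < b -> continuous_on (Icc a b) g -> g a = g b ->
  (forall t, Icc a b t -> A (g t)) ->
  exists d, 0 < d /\ forall l, fine_chain d a l -> chain_end a l = b ->
    chain_sum (fun x y _ => E (g x) (g y)) a l = 0.
Proof.
  intros [[HA _] Hsc] HE Hab Hg Hclosed HgA.
  assert (Hto : forall s, Icc 0 1 s -> Icc a b (a + s * (b - a))).
  { unfold Icc. intros s Hs. split; [nra|]. nra. }
  assert (Hfrom : forall t, Icc a b t -> Icc 0 1 ((t - a) * / (b - a))).
  { unfold Icc. intros t Ht. split.
    - apply Rmult_le_pos; [lra|]. left. apply Rinv_0_lt_compat. lra.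
    - apply Rmult_le_reg_r with (b - a); [lra|].
      rewrite Rmult_assoc, Rinv_l; lra. }
  destruct (Hsc (g a) (fun s => g (a + s * (b - a)))) as [H [Hc [HHA [H0 [H1 Hp]]]]].
  { split; [|split; [|split]].
    - apply (continuous_on_comp _ (Icc a b) (fun s => a + s * (b - a)) g); trivial.
      intros s _. apply (ex_derive_continuous (fun s => a + s * (b - a))).
      auto_derive. exact I.
    - f_equal. ring.
    - rewrite Hclosed. f_equal. ring.
    - intros s Hs. apply HgA, Hto, Hs. }
  destruct (potential_sums_vanish A P Q E a b (g a)
    (fun st => H (fst st, (snd st - a) * / (b - a)))) as [d [Hd Hv]]; trivial.
  - apply (continuous_on_comp _ _
      (fun st : R * R => (fst st, (snd st - a) * / (b - a))) H Hc).
    + intros [s t] _.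
      apply (continuous_comp_2 (fun st : R * R => fst st)
        (fun st : R * R => (snd st - a) * / (b - a)) (fun x y => (x, y))).
      * apply continuous_fst.
      * apply (continuous_comp snd (fun t => (t - a) * / (b - a))).
        -- apply continuous_snd.
        -- apply (ex_derive_continuous (fun t => (t - a) * / (b - a))).
           auto_derive. exact I.
      * apply (continuous_ext (fun z => z)).
        -- intros []; reflexivity.
        -- apply continuous_id.
    + intros st [Hs Ht]. split; [exact Hs | apply Hfrom, Ht].
  - intros s t Hs Ht. apply HHA; [exact Hs | apply Hfrom, Ht].
  - intros t Ht. apply H1, Hfrom, Ht.
  - intros s Hs. cbn [fst snd]. destruct (Hp s Hs) as [Ha Hb]. split.
    + now replace ((a - a) * / (b - a)) with 0 by ring.
    + now replace ((b - a) * / (b - a)) with 1 by (field; lra).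
  - exists d. split; [exact Hd|]. intros l Hf Hend.
    rewrite <- (Hv l Hf Hend).
    apply (chain_sum_ext a b d); trivial; try lra.
    assert (Hg0 : forall t, Icc a b t -> H (0, (t - a) * / (b - a)) = g t).
    { intros t Ht. rewrite H0 by (apply Hfrom, Ht). f_equal. field. lra. }
    intros x y xi Hx Hxi Hy. cbn [fst snd].
    now rewrite !Hg0 by (unfold Icc; lra).
Qed.

(** One fine enough subdivision suffices: its sum is close to [I], and also close
    to the sum of [E] along its vertices, which is zero. *)
Theorem form_integral_zero (A : C -> Prop) (P Q : C -> R) (E : C -> C -> R)
    (a b : R) (v : R -> R) (g : R -> C) (I : R) :
  simply_connected_domain A ->
  (forall z, A z -> continuous P z) -> (forall z, A z -> continuous Q z) ->
  local_potential A P Q E ->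
  a < b -> continuous_on (Icc a b) g -> g a = g b ->
  (forall t, Icc a b t -> A (g t)) ->
  dominated_by a b v (fun t => Re (g t)) ->
  dominated_by a b v (fun t => Im (g t)) ->
  filterlim (fun ptd => chain_sum (form_link P Q g) (SF_h ptd) (SF_t ptd))
    (Riemann_fine a b) (locally I) -> I = 0.
Proof.
  intros HA HP HQ HE Hab Hg Hclosed HgA Hre Him HI.
  destruct (Req_dec I 0) as [H0|H0]; [exact H0 | exfalso].
  assert (HV : 0 <= v b - v a).
  { eapply Rle_trans; [apply Rabs_pos | apply (Hre a b); lra]. }
  pose proof (Rabs_pos_lt I H0) as HIpos.
  assert (He : 0 < Rabs I / 2 / (v b - v a + 1)).
  { apply Rdiv_lt_0_compat; lra. }
  destruct (form_sums_close_to_potential A P Q E a b v g (proj1 (proj1 HA))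
              HP HQ HE Hg HgA Hre Him _ He) as [d1 [Hd1 H1]].
  destruct (loop_potential_sums_vanish A P Q E a b g HA HE Hab Hg Hclosed HgA)
    as [d2 [Hd2 H2]].
  assert (HI2 : 0 < Rabs I / 2) by lra.
  specialize (HI _ (locally_ball I (mkposreal _ HI2))). unfold filtermap in HI.
  pose proof (Riemann_fine_subdivision a b d1 Hab Hd1) as F1.
  pose proof (Riemann_fine_subdivision a b d2 Hab Hd2) as F2.
  pose proof (Riemann_fine_filter a b) as HF.
  destruct (filter_ex _ (filter_and _ _ HI (filter_and _ _ F1 F2)))
    as [[h l] [Hb [[Hh [Hend Hf1]] [_ [_ Hf2]]]]].
  cbn [SF_h SF_t] in *. subst h.
  specialize (H1 l Hf1 Hend). rewrite (H2 l Hf2 Hend) in H1.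
  change (Rabs (chain_sum (form_link P Q g) a l - I) < Rabs I / 2) in Hb.
  rewrite Rminus_0_r in H1.
  assert (Rabs I / 2 / (v b - v a + 1) * (v b - v a) <= Rabs I / 2).
  { replace (Rabs I / 2 / (v b - v a + 1) * (v b - v a))
      with (Rabs I / 2 - Rabs I / 2 / (v b - v a + 1)) by (field; lra). lra. }
  pose proof (Rabs_triang (chain_sum (form_link P Q g) a l)
                (- (chain_sum (form_link P Q g) a l - I))) as Ht.
  rewrite Rabs_Ropp in Ht.
  replace (chain_sum (form_link P Q g) a l
           + - (chain_sum (form_link P Q g) a l - I)) with I in Ht by ring.
  lra.
Qed.

(** * Potentials of closed forms *)

Lemma continuous_horizontal (P : C -> R) (x y : R) :
  continuous P (x, y) -> continuous (fun s => P (s, y)) x.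
Proof.
  intros H. apply (continuous_comp (fun s => (s, y) : C) P); [|exact H].
  apply (continuous_comp_2 (fun s : R => s) (fun _ => y) (fun s t => (s, t) : C)).
  - apply continuous_id.
  - apply continuous_const.
  - apply (continuous_ext (fun z : C => z)); [intros []; reflexivity|].
    apply continuous_id.
Qed.

Lemma continuous_vertical (P : C -> R) (x y : R) :
  continuous P (x, y) -> continuous (fun t => P (x, t)) y.
Proof.
  intros H. apply (continuous_comp (fun t => (x, t) : C) P); [|exact H].
  apply (continuous_comp_2 (fun _ : R => x) (fun t => t) (fun s t => (s, t) : C)).
  - apply continuous_const.
  - apply continuous_id.
  - apply (continuous_ext (fun z : C => z)); [intros []; reflexivity|].
    apply continuous_id.
Qed.

Lemma continuous_curried (P : C -> R) (x y : R) :
  continuity_2d_pt (fun u v => P (u, v)) x y <-> continuous P (x, y).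
Proof.
  rewrite continuity_2d_pt_filterlim. unfold continuous. split; apply filterlim_ext;
  intros []; reflexivity.
Qed.

Lemma continuous_locally_eq (P P' : C -> R) (A : C -> Prop) (z : C) :
  open A -> A z -> (forall w, A w -> P w = P' w) ->
  continuous P z -> continuous P' z.
Proof.
  intros HA Hz He. apply continuous_ext_loc.
  generalize (HA z Hz). apply filter_imp. exact He.
Qed.

Lemma ball_fiber (A : C -> Prop) (x y : R) :
  open A -> A (x, y) ->
  locally x (fun x' => A (x', y)) /\ locally y (fun y' => A (x, y')).
Proof.
  intros HA Hz. destruct (HA _ Hz) as [r Hr].
  split; exists r; intros t Ht; apply Hr; (split; [|]); trivial; apply ball_center.
Qed.

Definition elbow_integral (P Q : C -> R) (z w : C) : R :=
  RInt (fun s => P (s, Im z)) (Re z) (Re w)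
  + RInt (fun t => Q (Re w, t)) (Im z) (Im w).

(** The fundamental theorem of calculus on each of the two sides. *)
Lemma elbow_integral_potential (c : C) (r : posreal) (Phi P Q : C -> R) (z w : C) :
  has_partials_on (ball c r) Phi P Q ->
  (forall z, ball c r z -> continuous P z) ->
  (forall z, ball c r z -> continuous Q z) ->
  ball c r z -> ball c r w -> elbow_integral P Q z w = Phi w - Phi z.
Proof.
  intros HPhi HP HQ Hz Hw. unfold elbow_integral.
  assert (E1 : is_RInt (fun s => P (s, Im z)) (Re z) (Re w)
                 (Phi (Re w, Im z) - Phi (Re z, Im z))).
  { apply (is_RInt_derive (V := R_CompleteNormedModule) (fun s => Phi (s, Im z))
             (fun s => P (s, Im z))); intros s Hs;
      pose proof (ball_horizontal_side c z w r s Hz Hw Hs) as Hb.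
    - apply HPhi, Hb.
    - apply continuous_horizontal, HP, Hb. }
  assert (E2 : is_RInt (fun t => Q (Re w, t)) (Im z) (Im w)
                 (Phi (Re w, Im w) - Phi (Re w, Im z))).
  { apply (is_RInt_derive (V := R_CompleteNormedModule) (fun t => Phi (Re w, t))
             (fun t => Q (Re w, t))); intros t Ht;
      pose proof (ball_vertical_side c z w r t Hz Hw Ht) as Hb.
    - apply HPhi, Hb.
    - apply continuous_vertical, HQ, Hb. }
  apply (is_RInt_unique (V := R_CompleteNormedModule)) in E1.
  apply (is_RInt_unique (V := R_CompleteNormedModule)) in E2.
  rewrite E1, E2. destruct z, w; cbn. ring.
Qed.

(** [K] is the common value of [P_y] and [Q_x]. With [c] the centre, the
    primitive is [Phi (x, y) = int P (s, Im c) ds + int Q (x, t) dt], from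
    [Re c] to [x] and from [Im c] to [y]. Its derivative in [y] is [Q]; in [x]
    it is [P (x, Im c) + int Q_x (x, t) dt], where [Q_x = P_y] turns the
    integral into [P (x, y) - P (x, Im c)]. *)
Lemma closed_form_local_potential (A : C -> Prop) (P Q K : C -> R) :
  open A ->
  (forall z, A z -> continuous P z) -> (forall z, A z -> continuous Q z) ->
  (forall z, A z -> continuous K z) ->
  (forall x y, A (x, y) -> is_derive (fun y' => P (x, y')) y (K (x, y))) ->
  (forall x y, A (x, y) -> is_derive (fun x' => Q (x', y)) x (K (x, y))) ->
  local_potential A P Q (elbow_integral P Q).
Proof.
  intros HA HP HQ HK HPy HQx c r HcA.
  enough (Hpart : has_partials_on (ball c r) (elbow_integral P Q c) P Q).
  { exists (elbow_integral P Q c). split; [exact Hpart|].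
    intros z w Hz Hw.
    apply (elbow_integral_potential c r); auto. }
  intros x y Hxy. unfold elbow_integral. cbn [Re Im fst snd].
  assert (Hc : ball c r c) by apply ball_center.
  assert (Hx : forall t, Rmin (Im c) y <= t <= Rmax (Im c) y -> ball c r (x, t)).
  { intros t Ht. apply (ball_vertical_side c c (x, y) r t Hc Hxy Ht). }
  destruct (ball_fiber _ x y (open_square c r) Hxy) as [Hlx Hly].
  split.
  - assert (E1 : is_derive (fun x' => RInt (fun s => P (s, Im c)) (Re c) x') x
                   (P (x, Im c))).
    { apply (is_derive_RInt (fun s => P (s, Im c)) _ (Re c)).
      - revert Hlx. apply filter_imp. intros x' Hx'.
        apply (RInt_correct (V := R_CompleteNormedModule)), ex_RInt_continuous.
        intros s Hs. apply continuous_horizontal, HP, HcA.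
        apply (ball_horizontal_side c c (x', y)); trivial.
      - apply continuous_horizontal, HP, HcA.
        apply (ball_corner c c (x, y)); trivial. }
    assert (E2 : is_derive (fun x' => RInt (fun t => Q (x', t)) (Im c) y) x
                   (RInt (fun t => Derive (fun u => Q (u, t)) x) (Im c) y)).
    { apply (is_derive_RInt_param (fun x' t => Q (x', t))).
      - revert Hlx. apply filter_imp. intros x' Hx' t Ht.
        exists (K (x', t)). apply HQx, HcA.
        apply (ball_vertical_side c c (x', y) r t Hc Hx' Ht).
      - intros t Ht.
        apply (continuous_curried (fun z => Derive (fun u => Q (u, snd z)) (fst z))).
        apply (continuous_locally_eq K _ A); auto.
        intros [s s'] Hs. symmetry. apply is_derive_unique, HQx, Hs.
      - revert Hlx. apply filter_imp. intros x' Hx'.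
        apply (ex_RInt_continuous (V := R_CompleteNormedModule)).
        intros t Ht. apply continuous_vertical, HQ, HcA.
        apply (ball_vertical_side c c (x', y) r t Hc Hx' Ht). }
    assert (E3 : RInt (fun t => Derive (fun u => Q (u, t)) x) (Im c) y
                 = P (x, y) - P (x, Im c)).
    { rewrite (RInt_ext _ (fun t => K (x, t))).
      2:{ intros t Ht. apply is_derive_unique, HQx, HcA, Hx. lra. }
      apply (is_RInt_unique (V := R_CompleteNormedModule)).
      apply (is_RInt_derive (V := R_CompleteNormedModule) (fun t => P (x, t)));
        intros t Ht.
      - apply HPy, HcA, Hx, Ht.
      - apply continuous_vertical, HK, HcA, Hx, Ht. }
    replace (P (x, y)) with (plus (P (x, Im c)) (P (x, y) - P (x, Im c)))
      by (unfold plus; cbn; ring).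
    rewrite E3 in E2.
    apply (is_derive_plus (K := R_AbsRing) (V := R_NormedModule) _ _ x _ _ E1 E2).
  - assert (E2 : is_derive (fun y' => RInt (fun t => Q (x, t)) (Im c) y') y
                   (Q (x, y))).
    { apply (is_derive_RInt (fun t => Q (x, t)) _ (Im c)).
      - revert Hly. apply filter_imp. intros y' Hy'.
        apply (RInt_correct (V := R_CompleteNormedModule)), ex_RInt_continuous.
        intros t Ht. apply continuous_vertical, HQ, HcA.
        apply (ball_vertical_side c c (x, y')); trivial.
      - apply continuous_vertical, HQ, HcA, Hxy. }
    replace (Q (x, y)) with (plus 0 (Q (x, y))) by (unfold plus; cbn; ring).
    apply (is_derive_plus (K := R_AbsRing) (V := R_NormedModule)
             (fun _ => RInt (fun s => P (s, Im c)) (Re c) x)); [|exact E2].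
    apply (is_derive_const (K := R_AbsRing) (V := R_NormedModule)).
Qed.

(** * Complex curve integrals *)

Lemma curve_sum_parts (F : C -> C) (g : R -> C) (ptd : @SF_seq R) :
  curve_sum F g ptd
  = (chain_sum (form_link (fun z => Re (F z)) (fun z => - Im (F z)) g)
       (SF_h ptd) (SF_t ptd),
     chain_sum (form_link (fun z => Im (F z)) (fun z => Re (F z)) g)
       (SF_h ptd) (SF_t ptd)).
Proof.
  destruct ptd as [h l]. unfold curve_sum. cbn [SF_h SF_t].
  change h with (fst (h, 0)) at 2 3. generalize (h, 0) as p.
  induction l as [|[y xi] l IH]; intros p.
  - reflexivity.
  - cbn [seq.pairmap seq.foldr chain_sum]. rewrite IH. cbn [fst snd].
    unfold form_link, link.
    destruct (F (g xi)), (g y), (g (fst p)). unfold Cplus, Cmult, Cminus, Copp. cbn.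
    f_equal; ring.
Qed.

Lemma ex_form_integral (A : C -> Prop) (P Q : C -> R) (a b : R) (v : R -> R)
    (g : R -> C) :
  (forall z, A z -> continuous P z) -> (forall z, A z -> continuous Q z) ->
  a < b -> continuous_on (Icc a b) g -> (forall t, Icc a b t -> A (g t)) ->
  dominated_by a b v (fun t => Re (g t)) ->
  dominated_by a b v (fun t => Im (g t)) ->
  exists I : R,
    filterlim (fun ptd => chain_sum (form_link P Q g) (SF_h ptd) (SF_t ptd))
      (Riemann_fine a b) (locally I).
Proof.
  intros HP HQ Hab Hg HgA Hre Him.
  destruct (ex_stieltjes a b v (fun t => P (g t)) (fun t => Re (g t)) Hab Hre)
    as [I1 H1]; [apply (uniformly_continuous_along A); trivial|].
  destruct (ex_stieltjes a b v (fun t => Q (g t)) (fun t => Im (g t)) Hab Him)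
    as [I2 H2]; [apply (uniformly_continuous_along A); trivial|].
  exists (I1 + I2).
  pose proof (Riemann_fine_filter a b).
  apply (filterlim_ext (fun ptd => link_sum (fun t => P (g t)) (fun t => Re (g t)) ptd
                        + link_sum (fun t => Q (g t)) (fun t => Im (g t)) ptd)).
  - intros ptd. unfold form_link. rewrite chain_sum_plus. reflexivity.
  - apply (filterlim_comp_2 (G := locally I1) (H := locally I2) _ _ Rplus H1 H2).
    apply (filterlim_plus (V := R_NormedModule) I1 I2).
Qed.

(** [(p + i q) (dx + i dy) = (p dx - q dy) + i (q dx + p dy)]; the sums see [F]
    only on the curve, so it is enough to know [F] on a set containing it. *)
Lemma ex_CurveInt_parts (A : C -> Prop) (F : C -> C) (p q : C -> R)
    (a b : R) (v : R -> R) (g : R -> C) :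
  (forall z, A z -> F z = (p z, q z)) ->
  (forall z, A z -> continuous p z) -> (forall z, A z -> continuous q z) ->
  a < b -> continuous_on (Icc a b) g -> (forall t, Icc a b t -> A (g t)) ->
  dominated_by a b v (fun t => Re (g t)) ->
  dominated_by a b v (fun t => Im (g t)) ->
  exists I : C, is_CurveInt F g a b I /\
    filterlim (fun ptd => chain_sum (form_link p (fun z => - q z) g)
                            (SF_h ptd) (SF_t ptd))
      (Riemann_fine a b) (locally (Re I)) /\
    filterlim (fun ptd => chain_sum (form_link q p g) (SF_h ptd) (SF_t ptd))
      (Riemann_fine a b) (locally (Im I)).
Proof.
  intros HF Hp Hq Hab Hg HgA Hre Him.
  assert (Hq' : forall z, A z -> continuous (fun z => - q z) z).
  { intros z Hz. apply (continuous_opp (V := R_NormedModule) q z), Hq, Hz. }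
  destruct (ex_form_integral A p (fun z => - q z) a b v g) as [I1 H1]; trivial.
  destruct (ex_form_integral A q p a b v g) as [I2 H2]; trivial.
  exists (I1, I2). split; [|split; assumption].
  unfold is_CurveInt.
  pose proof (Riemann_fine_filter a b).
  assert (H12 : filterlim
    (fun ptd => (chain_sum (form_link p (fun z => - q z) g) (SF_h ptd) (SF_t ptd),
                 chain_sum (form_link q p g) (SF_h ptd) (SF_t ptd)))
    (Riemann_fine a b) (locally ((I1, I2) : C))).
  { apply filterlim_locally. intros eps.
    pose proof (proj1 (filterlim_locally _ I1) H1 eps) as G1.
    pose proof (proj1 (filterlim_locally _ I2) H2 eps) as G2.
    generalize (filter_and _ _ G1 G2). apply filter_imp.
    intros ptd [K1 K2]. split; assumption. }
  revert H12. apply filterlim_ext_loc.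
  generalize (Riemann_fine_subdivision a b 1 Hab Rlt_0_1). apply filter_imp.
  intros [h l] [Hh [He Hf]]. cbn in Hh, He, Hf. subst h.
  rewrite curve_sum_parts. cbn [SF_h SF_t].
  f_equal; apply (chain_sum_ext a b 1); trivial; try lra;
    intros x y xi Hx Hxi Hy; unfold form_link, link;
    rewrite HF by (apply HgA; unfold Icc; lra); reflexivity.
Qed.

(** * The Schrodinger equation *)

Definition partial_x (f : C -> R) (z : C) : R := Derive (fun x => f (x, Im z)) (Re z).
Definition partial_y (f : C -> R) (z : C) : R := Derive (fun y => f (Re z, y)) (Im z).

Lemma C2_first_order (A : C -> Prop) (f : C -> R) (x y : R) :
  C2_on A f -> A (x, y) ->
  is_derive (fun x' => f (x', y)) x (partial_x f (x, y)) /\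
  is_derive (fun y' => f (x, y')) y (partial_y f (x, y)) /\
  continuous f (x, y) /\
  continuous (partial_x f) (x, y) /\ continuous (partial_y f) (x, y).
Proof.
  intros Hf Hz.
  destruct (Hf _ Hz) as [H0 [Hx [Hy [[Hcx _] [Hcy _]]]]]. cbn in *.
  split; [apply Derive_correct, Hx|]. split; [apply Derive_correct, Hy|].
  split; [apply continuous_curried, H0|].
  split; apply continuous_curried; assumption.
Qed.

Lemma C2_second_order (A : C -> Prop) (f : C -> R) (x y : R) :
  C2_on A f -> A (x, y) ->
  is_derive (fun x' => partial_x f (x', y)) x (partial_x (partial_x f) (x, y)) /\
  is_derive (fun y' => partial_y f (x, y')) y (partial_y (partial_y f) (x, y)) /\
  continuous (partial_x (partial_x f)) (x, y) /\
  continuous (partial_y (partial_y f)) (x, y).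
Proof.
  intros Hf Hz.
  destruct (Hf _ Hz) as [_ [_ [_ [Hcx Hcy]]]].
  destruct Hcx as [_ [H1 [_ [[C1 _] _]]]].
  destruct Hcy as [_ [_ [H2 [_ [C2 _]]]]].
  cbn in *.
  split; [apply Derive_correct, H1|]. split; [apply Derive_correct, H2|].
  split; apply continuous_curried; assumption.
Qed.

Lemma d_x_real (f : C -> R) (z : C) :
  d_x (fun w => RtoC (f w)) z = RtoC (partial_x f z).
Proof. unfold d_x, partial_x. cbn. now rewrite Derive_const. Qed.

Lemma d_y_real (f : C -> R) (z : C) :
  d_y (fun w => RtoC (f w)) z = RtoC (partial_y f z).
Proof. unfold d_y, partial_y. cbn. now rewrite Derive_const. Qed.

Lemma d_z_real (f : C -> R) (z : C) :
  d_z (fun w => RtoC (f w)) z = (partial_x f z, - partial_y f z).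
Proof.
  unfold d_z. rewrite d_x_real, d_y_real. apply injective_projections; cbn; ring.
Qed.

Lemma d_zbar_real (f : C -> R) (z : C) :
  d_zbar (fun w => RtoC (f w)) z = (partial_x f z, partial_y f z).
Proof.
  unfold d_zbar. rewrite d_x_real, d_y_real. apply injective_projections; cbn; ring.
Qed.

(** Real part of the equation: the imaginary part involves only the mixed
    derivatives of [f]. *)
Lemma schrodinger_laplacian (A : C -> Prop) (u f : C -> R) (z : C) :
  schrodinger_solution A u f -> A z ->
  partial_x (partial_x f) z + partial_y (partial_y f) z = u z * f z.
Proof.
  intros [_ H] Hz. specialize (H z Hz). apply (f_equal Re) in H.
  cbn in H. unfold d_z, d_x, d_y in H. cbn in H.
  rewrite (Derive_ext (fun x => Re (d_zbar (fun w => RtoC (f w)) (x, Im z)))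
             (fun x => partial_x f (x, Im z))) in H
    by (intros t; now rewrite d_zbar_real).
  rewrite (Derive_ext (fun y => Im (d_zbar (fun w => RtoC (f w)) (Re z, y)))
             (fun y => partial_y f (Re z, y))) in H
    by (intros t; now rewrite d_zbar_real).
  unfold partial_x at 1, partial_y at 1. lra.
Qed.

(** * The two forms of a quotient of solutions *)

(** [d] is a partial derivative, or an iterated one. *)
Definition wronskian (d : (C -> R) -> C -> R) (f0 f1 : C -> R) (z : C) : R :=
  f0 z * d f1 z - f1 z * d f0 z.

Lemma is_derive_quotient (f0 f1 : R -> R) (t d0 d1 : R) :
  f0 t <> 0 -> is_derive f0 t d0 -> is_derive f1 t d1 ->
  is_derive (fun s => f1 s / f0 s) t ((f0 t * d1 - f1 t * d0) / f0 t ^ 2).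
Proof.
  intros Hnz H0 H1.
  evar_last; [apply (is_derive_div f1 f0 t d1 d0 H1 H0 Hnz)|].
  change (@eq R ((d1 * f0 t - f1 t * d0) / f0 t ^ 2)
            ((f0 t * d1 - f1 t * d0) / f0 t ^ 2)).
  now field.
Qed.

Lemma partials_quotient (A : C -> Prop) (f0 f1 : C -> R) (x y : R) :
  C2_on A f0 -> C2_on A f1 -> nonvanishing_on A f0 -> A (x, y) ->
  is_derive (fun x' => f1 (x', y) / f0 (x', y)) x
    (wronskian partial_x f0 f1 (x, y) / f0 (x, y) ^ 2) /\
  is_derive (fun y' => f1 (x, y') / f0 (x, y')) y
    (wronskian partial_y f0 f1 (x, y) / f0 (x, y) ^ 2).
Proof.
  intros H0 H1 Hnz Hz. specialize (Hnz _ Hz).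
  destruct (C2_first_order A f0 x y H0 Hz) as [X0 [Y0 _]].
  destruct (C2_first_order A f1 x y H1 Hz) as [X1 [Y1 _]].
  split.
  - exact (is_derive_quotient (fun s => f0 (s, y)) (fun s => f1 (s, y)) x _ _ Hnz X0 X1).
  - exact (is_derive_quotient (fun s => f0 (x, s)) (fun s => f1 (x, s)) y _ _ Hnz Y0 Y1).
Qed.

Lemma continuous_wronskian (d : (C -> R) -> C -> R) (f0 f1 : C -> R) (z : C) :
  continuous f0 z -> continuous f1 z -> continuous (d f0) z -> continuous (d f1) z ->
  continuous (wronskian d f0 f1) z.
Proof.
  intros C0 C1 D0 D1. unfold wronskian.
  apply (continuous_minus (V := R_NormedModule) (fun z => f0 z * d f1 z)
           (fun z => f1 z * d f0 z)).
  - apply (continuous_mult (K := R_AbsRing) f0 (d f1)); assumption.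
  - apply (continuous_mult (K := R_AbsRing) f1 (d f0)); assumption.
Qed.

Lemma is_derive_wronskian (f0 f1 df0 df1 : R -> R) (t d0 d1 : R) :
  is_derive f0 t (df0 t) -> is_derive f1 t (df1 t) ->
  is_derive df0 t d0 -> is_derive df1 t d1 ->
  is_derive (fun s => f0 s * df1 s - f1 s * df0 s) t (f0 t * d1 - f1 t * d0).
Proof.
  intros H0 H1 D0 D1.
  evar_last.
  - apply (is_derive_minus (K := R_AbsRing) (V := R_NormedModule)).
    + apply (is_derive_mult _ _ _ _ _ H0 D1). intros; apply Rmult_comm.
    + apply (is_derive_mult _ _ _ _ _ H1 D0). intros; apply Rmult_comm.
  - unfold minus, plus, opp, mult; cbn. ring.
Qed.

(** The cross products of first derivatives cancel, which leaves
    [d/dx (f0 f1_x - f1 f0_x) = f0 f1_xx - f1 f0_xx] and likewise in [y]; with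
    [f_xx = u f - f_yy] for both solutions the terms in [u] cancel, so
    [f0 f1_xx - f1 f0_xx = - (f0 f1_yy - f1 f0_yy)]. *)
Lemma wronskian_form_local_potential (A : C -> Prop) (u f0 f1 : C -> R) :
  open A -> schrodinger_solution A u f0 -> schrodinger_solution A u f1 ->
  local_potential A (fun z => - wronskian partial_y f0 f1 z) (wronskian partial_x f0 f1)
    (elbow_integral (fun z => - wronskian partial_y f0 f1 z)
       (wronskian partial_x f0 f1)).
Proof.
  intros HA S0 S1.
  apply (closed_form_local_potential A _ _
           (wronskian (fun f => partial_x (partial_x f)) f0 f1) HA).
  - intros [x y] Hz.
    destruct (C2_first_order A f0 x y (proj1 S0) Hz) as [_ [_ [? [? ?]]]].
    destruct (C2_first_order A f1 x y (proj1 S1) Hz) as [_ [_ [? [? ?]]]].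
    apply (continuous_opp (V := R_NormedModule) (wronskian partial_y f0 f1)).
    now apply continuous_wronskian.
  - intros [x y] Hz.
    destruct (C2_first_order A f0 x y (proj1 S0) Hz) as [_ [_ [? [? ?]]]].
    destruct (C2_first_order A f1 x y (proj1 S1) Hz) as [_ [_ [? [? ?]]]].
    now apply continuous_wronskian.
  - intros [x y] Hz.
    destruct (C2_first_order A f0 x y (proj1 S0) Hz) as [_ [_ [? _]]].
    destruct (C2_first_order A f1 x y (proj1 S1) Hz) as [_ [_ [? _]]].
    destruct (C2_second_order A f0 x y (proj1 S0) Hz) as [_ [_ [? _]]].
    destruct (C2_second_order A f1 x y (proj1 S1) Hz) as [_ [_ [? _]]].
    now apply continuous_wronskian.
  - intros x y Hz.
    destruct (C2_first_order A f0 x y (proj1 S0) Hz) as [_ [Y0 _]].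
    destruct (C2_first_order A f1 x y (proj1 S1) Hz) as [_ [Y1 _]].
    destruct (C2_second_order A f0 x y (proj1 S0) Hz) as [_ [YY0 _]].
    destruct (C2_second_order A f1 x y (proj1 S1) Hz) as [_ [YY1 _]].
    pose proof (schrodinger_laplacian A u f0 _ S0 Hz) as L0.
    pose proof (schrodinger_laplacian A u f1 _ S1 Hz) as L1.
    evar_last.
    + apply (is_derive_opp (K := R_AbsRing) (V := R_NormedModule)).
      exact (is_derive_wronskian (fun t => f0 (x, t)) (fun t => f1 (x, t))
               (fun t => partial_y f0 (x, t)) (fun t => partial_y f1 (x, t)) y _ _ Y0 Y1 YY0 YY1).
    + unfold wronskian, opp; cbn.
      replace (partial_x (partial_x f0) (x, y))
        with (u (x, y) * f0 (x, y) - partial_y (partial_y f0) (x, y)) by lra.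
      replace (partial_x (partial_x f1) (x, y))
        with (u (x, y) * f1 (x, y) - partial_y (partial_y f1) (x, y)) by lra.
      ring.
  - intros x y Hz.
    destruct (C2_first_order A f0 x y (proj1 S0) Hz) as [X0 _].
    destruct (C2_first_order A f1 x y (proj1 S1) Hz) as [X1 _].
    destruct (C2_second_order A f0 x y (proj1 S0) Hz) as [XX0 _].
    destruct (C2_second_order A f1 x y (proj1 S1) Hz) as [XX1 _].
    exact (is_derive_wronskian (fun t => f0 (t, y)) (fun t => f1 (t, y))
             (fun t => partial_x f0 (t, y)) (fun t => partial_x f1 (t, y)) x _ _ X0 X1 XX0 XX1).
Qed.

Lemma schrodinger_solution_subset (A B : C -> Prop) (u f : C -> R) :
  (forall z, A z -> B z) -> schrodinger_solution B u f -> schrodinger_solution A u f.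
Proof. intros H [H1 H2]. split; intros z Hz; auto. Qed.

Theorem theorem26
  (Omega : C -> Prop) (u f0 f1 : C -> R)
  (hOmega : planar_domain Omega)
  (hu : C2_on Omega u)
  (hf0 : schrodinger_solution Omega u f0)
  (hf1 : schrodinger_solution Omega u f1)
  (nz0 : nonvanishing_on Omega f0)
  (nz1 : nonvanishing_on Omega f1)
  (D : C -> Prop)
  (hD : simply_connected_domain D)
  (hDOmega : forall z, D z -> Omega z)
  (a b : R) (Gamma : R -> C)
  (hGamma : closed_rectifiable_curve a b Gamma)
  (hGammaD : forall t, Icc a b t -> D (Gamma t)) :
  let q := fun z : C => RtoC (f1 z / f0 z) in
  let F := d_z q in
  let G := fun z : C => (RtoC (f0 z ^ 2) * d_z q z)%C in
  ex_CurveInt F Gamma a b /\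
  ex_CurveInt G Gamma a b /\
  (RtoC (Re (CurveInt F Gamma a b)) + Ci * RtoC (Im (CurveInt G Gamma a b)))%C
  = RtoC 0.
Proof.
  intros q F G.
  apply (schrodinger_solution_subset D) in hf0; trivial.
  apply (schrodinger_solution_subset D) in hf1; trivial.
  assert (Hnz : nonvanishing_on D f0) by (intros z Hz; auto).
  pose proof (proj1 (proj1 hD)) as Dopen.
  destruct hGamma as [Hab [Hcont [Hclosed Hrect]]].
  destruct (rectifiable_variation a b Gamma Hrect) as [v [Hre Him]].
  (* [Wx] and [Wy] are the partial derivatives of the quotient multiplied by
     [f0 ^ 2]. *)
  pose (Wx := wronskian partial_x f0 f1). pose (Wy := wronskian partial_y f0 f1).
  assert (Hquot : forall z, D z -> d_z q z = (Wx z / f0 z ^ 2, - (Wy z / f0 z ^ 2))).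
  { intros [x y] Hz. unfold q. rewrite d_z_real.
    destruct (partials_quotient D f0 f1 x y (proj1 hf0) (proj1 hf1) Hnz Hz) as [Qx Qy].
    f_equal; [|f_equal]; apply is_derive_unique; assumption. }
  assert (Hc : forall z, D z ->
            continuous f0 z /\ continuous Wx z /\ continuous Wy z).
  { intros [x y] Hz.
    destruct (C2_first_order D f0 x y (proj1 hf0) Hz) as [_ [_ [? [? ?]]]].
    destruct (C2_first_order D f1 x y (proj1 hf1) Hz) as [_ [_ [? [? ?]]]].
    split; [assumption|]. split; now apply continuous_wronskian. }
  assert (Hdiv : forall W : C -> R, (forall z, D z -> continuous W z) ->
            forall z, D z -> continuous (fun z => W z / f0 z ^ 2) z).
  { intros W HW z Hz.
    apply (continuous_mult (K := R_AbsRing) W (fun z => / f0 z ^ 2)); [auto|].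
    apply (continuous_comp f0 (fun t => / t ^ 2)); [exact (proj1 (Hc z Hz))|].
    apply (ex_derive_continuous (fun t => / t ^ 2)).
    auto_derive. exact (pow_nonzero (f0 z) 2 (Hnz z Hz)). }
  assert (HWx : forall z, D z -> continuous Wx z)
    by (intros z Hz; exact (proj1 (proj2 (Hc z Hz)))).
  assert (HWy : forall z, D z -> continuous Wy z)
    by (intros z Hz; exact (proj2 (proj2 (Hc z Hz)))).
  assert (Hopp : forall W : C -> R, (forall z, D z -> continuous W z) ->
            forall z, D z -> continuous (fun z => - W z) z).
  { intros W HW z Hz. apply (continuous_opp (V := R_NormedModule) W), HW, Hz. }
  destruct (ex_CurveInt_parts D F (fun z => Wx z / f0 z ^ 2)
              (fun z => - (Wy z / f0 z ^ 2)) a b v Gamma)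
    as [IF [HF [HFre _]]]; auto.
  destruct (ex_CurveInt_parts D G Wx (fun z => - Wy z) a b v Gamma)
    as [IG [HG [_ HGim]]]; auto.
  { intros z Hz. unfold G. rewrite Hquot by exact Hz. specialize (Hnz z Hz).
    apply injective_projections; cbn; now field. }
  (* The double sign: [- q_y] is the imaginary part of [d_z q], and the real
     part of the integral sees minus that imaginary part. A global primitive
     is the quotient itself. *)
  assert (HFD : local_potential D (fun z => Wx z / f0 z ^ 2)
            (fun z => - - (Wy z / f0 z ^ 2))
            (fun z w => f1 w / f0 w - f1 z / f0 z)).
  { intros c r Hcr. exists (fun z => f1 z / f0 z). split; [|reflexivity].
    intros x y Hz. rewrite Ropp_involutive.
    apply (partials_quotient D f0 f1 x y (proj1 hf0) (proj1 hf1) Hnz), Hcr, Hz. }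
  apply (form_integral_zero D _ _ _ a b v) with (4 := HFD) in HFre; auto.
  apply (form_integral_zero D _ _ _ a b v) with
    (4 := wronskian_form_local_potential D u f0 f1 Dopen hf0 hf1) in HGim; auto.
  split; [exists IF; exact HF|]. split; [exists IG; exact HG|].
  rewrite (is_CurveInt_unique _ _ _ _ _ HF), (is_CurveInt_unique _ _ _ _ _ HG).
  rewrite HFre, HGim. apply injective_projections; cbn; ring.
Qed.
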